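(* Let $\mathcal{C}$ be an irredundant covering of $\mathbb{Z}^2$ by lattices. If all the indices $[\mathbb{Z}^2:L]$, $L\in\mathcal{C}$, are powers of one prime $p$, then $\mathcal{C}$ is obtained from the trivial covering $\{\mathbb{Z}^2\}$ by (zero or more) successive $p$-refinement operations.
   Context: A lattice is a subgroup of $\mathbb{Z}^2$ of finite index; it is cocyclic if $\mathbb{Z}^2/L$ is cyclic. A covering (of $\mathbb{Z}^2$) is a finite collection (set) $\mathcal{C}$ of lattices whose union is $\mathbb{Z}^2$. A covering is irredundant if no proper subset of it is a covering (all lattices in an irredundant covering are automatically cocyclic). For a prime $p$, the $p$-descendants of a cocyclic lattice $L$ are the cocyclic lattices $L'\subseteq L$ with $[L:L']=p$ (there are $p$ of them if $p\mid[\mathbb{Z}^2:L]$ and $p+1$ otherwise). A $p$-refinement of a covering $\mathcal{C}$ by cocyclic lattices is the covering obtained by replacing one lattice $L\in\mathcal{C}$ by all of its $p$-descendants. *)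

(* Defs.v *)
From mathcomp Require Import all_boot all_order all_algebra.
From mathcomp Require Import finmap.
From mathcomp Require Import mathcomp_extra boolp classical_sets functions cardinality.
From Stdlib Require Import Relation_Operators.

Set Implicit Arguments.
Unset Strict Implicit.
Unset Printing Implicit Defensive.

Import GRing.Theory.
Local Open Scope ring_scope.
Local Open Scope classical_set_scope.

Notation Z2 := (int * int)%type.

Definition zcoset (L : set Z2) (x : Z2) : set Z2 := [set x + y | y in L].

Definition zcosets (M L : set Z2) : set (set Z2) := [set zcoset L x | x in M].

(* The index [M : L] for a subgroup L of M; its value is 0 when the index is
   infinite, since [fset_set] sends infinite sets to [fset0]. *)
Definition zindex (M L : set Z2) : nat := #|` fset_set (zcosets M L)|.

Definition lattice (L : set Z2) : Prop :=
  zmod_closed [in L] /\ finite_set (zcosets setT L).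

(* In the quotient, the k-th multiple of the class of g is the class of k g. *)
Definition cyclic_quotient (L : set Z2) : Prop :=
  exists g : Z2, zcosets setT L = [set zcoset L (g *~ k) | k in [set: int]].

Definition cocyclic (L : set Z2) : Prop := lattice L /\ cyclic_quotient L.

Definition covering (C : set (set Z2)) : Prop :=
  [/\ finite_set C, C `<=` lattice & \bigcup_(L in C) L = setT].

Definition irredundant_covering (C : set (set Z2)) : Prop :=
  covering C /\ forall D : set (set Z2), D `<` C -> ~ covering D.

Definition descendants (p : nat) (L : set Z2) : set (set Z2) :=
  [set L' | [/\ cocyclic L', L' `<=` L & zindex L L' = p]].

Definition p_refinement (p : nat) (C C' : set (set Z2)) : Prop :=
  [/\ covering C, C `<=` cocyclic &
      exists2 L, C L & C' = (C `\ L) `|` descendants p L].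

Definition p_refinements (p : nat) : set (set Z2) -> set (set Z2) -> Prop :=
  clos_refl_trans _ (p_refinement p).

(* Main.v *)
Require Import Defs.
From mathcomp Require Import all_boot all_order all_algebra.
From mathcomp Require Import finmap.
From mathcomp Require Import mathcomp_extra boolp classical_sets functions cardinality.

From mathcomp Require Import ring zify.
From Stdlib Require Import Relation_Operators.

(* For x not in p Z^2, the lattice {y : p^k | det(x, y)} is the only lattice of
   index p^k containing x: by Lagrange such a lattice contains Z x + p^k Z^2.
   Since every vector is a multiple of some x not in p Z^2, the members of an
   irredundant covering are of this form.  Each x lies in exactly one such
   lattice for each k, so these lattices form a tree under inclusion and a covering
   without strict inclusions is a cut of this tree.  A member of maximal index has
   all its siblings in the covering; replacing them by their common parent undoes
   a refinement and decreases the sum of the indices. *)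

Import GRing.Theory.
Local Open Scope ring_scope.
Local Open Scope classical_set_scope.

(** * Subgroups of [Z2], their cosets and Lagrange's theorem *)

Section Subgroups.

Context {L : set Z2} (Lz : zmod_closed [in L]).

Lemma mem_zmod0 : L 0.
Proof. by rewrite -in_setE; case: Lz. Qed.

Lemma mem_zmodB x y : L x -> L y -> L (x - y).
Proof. by move=> /mem_set Lx /mem_set Ly; apply: set_mem; case: Lz => _; exact. Qed.

Lemma mem_zmodN x : L x -> L (- x).
Proof. by move=> Lx; rewrite -sub0r; apply: mem_zmodB => //; exact: mem_zmod0. Qed.

Lemma mem_zmodD x y : L x -> L y -> L (x + y).
Proof. by move=> Lx Ly; rewrite -(opprK y); apply: mem_zmodB => //; exact: mem_zmodN. Qed.

Lemma mem_zmodMn x n : L x -> L (x *+ n).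
Proof.
move=> Lx; elim: n => [|n IHn]; first exact: mem_zmod0.
by rewrite mulrS; exact: mem_zmodD.
Qed.

Lemma mem_zmodMz x k : L x -> L (x *~ k).
Proof.
move=> Lx; case: k => n; first exact: mem_zmodMn.
by apply: mem_zmodN; exact: mem_zmodMn.
Qed.

Lemma zcoset_eqP {x y} : zcoset L x = zcoset L y <-> L (x - y).
Proof.
split=> [E | Lxy].
  have : zcoset L x x by exists 0; [exact: mem_zmod0 | rewrite addr0].
  by rewrite E => -[z Lz' <-]; rewrite addrAC subrr add0r.
apply/seteqP; split=> _ [z Lz' <-].
  exists (x - y + z); first exact: mem_zmodD.
  by rewrite addrA [y + _]addrC subrK.
exists (z - (x - y)); first exact: mem_zmodB.
by rewrite opprB addrCA [x + _]addrC subrK addrC.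
Qed.

(* Lagrange: translation by y permutes the cosets, so that summing their
   representatives before and after translation shows that n y is in L. *)
Lemma mem_zmod_index (Lfin : finite_set (zcosets setT L)) y : L (y *+ zindex setT L).
Proof.
pose F := fset_set (zcosets setT L).
have Frep (c : set Z2) : {x | c \in F -> c = zcoset L x}.
  apply: cid; case: (boolP (c \in F)) => [|_]; last by exists 0.
  by rewrite in_fset_set // in_setE => -[x _ <-]; exists x.
pose r c := projT1 (Frep c).
have rE c : c \in F -> zcoset L (r c) = c by move=> Fc; rewrite {2}(projT2 (Frep c) Fc).
have inF x : zcoset L x \in F by rewrite in_fset_set // in_setE; exists x.
pose t c := zcoset L (r c + y).
have tinj : {in F &, injective t}.
  move=> c d Fc Fd /zcoset_eqP h; rewrite -(rE c Fc) -(rE d Fd); apply/zcoset_eqP.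
  by move: h; rewrite opprD addrACA subrr addr0.
have tperm : perm_eq (map t F) F.
  have tuniq : uniq (map t F) by rewrite map_inj_in_uniq ?fset_uniq.
  apply: uniq_perm => //; first exact: fset_uniq.
  have tsub : {subset map t F <= F} by move=> _ /mapP[c _ ->]; exact: inF.
  by case: (uniq_min_size tuniq tsub _) => //; rewrite size_map.
have Esum : \sum_(c <- F) r (t c) = \sum_(c <- F) r c.
  by rewrite -(big_map t xpredT r); exact: perm_big.
(* [r (t c)] represents the coset of [r c + y], so every term lies in [L]. *)
have : L (\sum_(c <- F) (r c + y - r (t c))).
  rewrite big_seq; apply: (big_ind L) => [||c Fc]; first exact: mem_zmod0.
    by move=> ? ?; exact: mem_zmodD.
  by apply/zcoset_eqP; rewrite (rE (t c)) ?inF.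
rewrite sumrB big_split /= Esum addrAC subrr add0r.
by rewrite big_const_seq count_predT iter_addr_0.
Qed.

End Subgroups.

(** * Multiplicativity of the index *)

Lemma zcosetsS (M L : set Z2) : zcosets M L `<=` zcosets setT L.
Proof. by move=> _ [x _ <-]; exists x. Qed.

Lemma card_fsetM (K K' : choiceType) (A : {fset K}) (B : {fset K'}) :
  #|` A `*` B|%fset = (#|` A| * #|` B|)%N.
Proof.
rewrite -[RHS](size_allpairs pair); apply/perm_size/uniq_perm => [||[x y]].
- exact: fset_uniq.
- by apply: allpairs_uniq => [||[? ?] [? ?] _ _ //]; exact: fset_uniq.
by rewrite in_fsetM; apply/andP/allpairsP => [[Ax By]|[[? ?] [Ax By [-> ->]]]] //; exists (x, y).
Qed.

(** With representatives [r] of the cosets of [M] and [s] of the cosets of [L] in [M], each coset of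
    [L] contains [r a + s b] for exactly one pair [(a, b)]. *)
Lemma zindexM {M L : set Z2} : lattice M -> lattice L -> L `<=` M ->
  zindex setT L = (zindex setT M * zindex M L)%N.
Proof.
move=> [Mz Mfin] [Lz Lfin] LM.
have MLfin : finite_set (zcosets M L) by apply: sub_finite_set Lfin; exact: zcosetsS.
have rep (N A : set Z2) (c : set Z2) : {x | zcosets N A c -> N x /\ c = zcoset A x}.
  apply: cid; have [[x Nx <-]|h] := pselect (zcosets N A c); first by exists x.
  by exists 0 => /h.
pose r c := projT1 (rep setT M c).
have rE c : zcosets setT M c -> c = zcoset M (r c) by move=> /(projT2 (rep setT M c))[].
pose s c := projT1 (rep M L c).
have sE c : zcosets M L c -> M (s c) /\ c = zcoset L (s c) by move=> /(projT2 (rep M L c)).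
pose h (u : set Z2 * set Z2) := zcoset L (r u.1 + s u.2).
have -> : zindex setT L = #|` fset_set (h @` (zcosets setT M `*` zcosets M L))|.
  congr (#|` fset_set _|); apply/seteqP; split=> [_ [x _ <-]|_ [u _ <-]]; last by eexists.
  have /(rE _)/(zcoset_eqP Mz) Mx : zcosets setT M (zcoset M x) by exists x.
  have cy : zcosets M L (zcoset L (x - r (zcoset M x))) by eexists; first exact: Mx.
  exists (zcoset M x, zcoset L (x - r (zcoset M x))); first by split => //=; exists x.
  have [_ /(zcoset_eqP Lz) Ly] := sE _ cy.
  apply/(zcoset_eqP Lz) => /=; rewrite -opprB; apply: mem_zmodN => //.
  by rewrite opprD addrA.
rewrite fset_set_image; last exact: finite_setX.
rewrite card_in_imfset; first by rewrite fset_setX // card_fsetM.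
move=> [a b] [c d]; rewrite !in_fset_set ?inE; try exact: finite_setX.
move=> -[/= Ma Mb] [/= Mc Md] /(zcoset_eqP Lz) /= h1.
have [sb eb] := sE _ Mb; have [sd ed] := sE _ Md.
(* Modulo [M] the terms [s b] and [s d] vanish, which settles the outer cosets first. *)
have eac : a = c.
  rewrite (rE _ Ma) (rE _ Mc); apply/(zcoset_eqP Mz).
  have -> : r a - r c = r a + s b - (r c + s d) - (s b - s d).
    by rewrite opprD addrACA addrK.
  by apply: (mem_zmodB Mz); [exact: LM | exact: mem_zmodB].
congr pair => //; rewrite eb ed; apply/(zcoset_eqP Lz).
by move: h1; rewrite eac opprD addrACA subrr add0r.
Qed.

Lemma zindex_gt0 {L : set Z2} : lattice L -> (0 < zindex setT L)%N.
Proof.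
move=> [_ Lfin]; rewrite cardfs_gt0; apply/fset0Pn; exists (zcoset L 0).
by rewrite in_fset_set // in_setE; exists 0.
Qed.

(** Multiplicativity forces [zindex M L] to be 1, so every element of [M] is in the coset of 0. *)
Lemma eq_lattice_index {L M : set Z2} : lattice L -> lattice M -> L `<=` M ->
  zindex setT L = zindex setT M -> L = M.
Proof.
move=> Ll Ml LM; have [[Lz Lfin] [Mz _]] := (Ll, Ml).
rewrite (zindexM Ml Ll LM) -[RHS]muln1 => /eqP.
rewrite eqn_pmul2l ?zindex_gt0 // => /cardfs1P[c Ec].
have inc y : M y -> zcoset L y = c.
  move=> My; have : zcoset L y \in fset_set (zcosets M L).
    rewrite in_fset_set; first by rewrite in_setE; exists y.
    by apply: sub_finite_set Lfin; exact: zcosetsS.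
  by rewrite Ec inE => /eqP.
apply/seteqP; split=> // y My; rewrite -(subr0 y); apply/(zcoset_eqP Lz).
by rewrite !inc //; exact: mem_zmod0.
Qed.

(** * The lattices of prime power index attached to a primitive vector *)

Definition det2 (x y : Z2) : int := x.1 * y.2 - x.2 * y.1.

Lemma det2B x y z : det2 x (y - z) = det2 x y - det2 x z.
Proof. rewrite /det2 /=; ring. Qed.

Lemma det2Mz x y k : det2 x (y *~ k) = k * det2 x y.
Proof. by rewrite /det2 !(raddfMz fst) !(raddfMz snd) !mulrzz; ring. Qed.

Definition primitive_mod (p : nat) (x : Z2) : bool :=
  ~~ ((p%:Z %| x.1)%Z && (p%:Z %| x.2)%Z).

Definition det_lattice (q : nat) (x : Z2) : set Z2 := [set y | (q%:Z %| det2 x y)%Z].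

Section DetLattice.

Context {p : nat} (p_prime : prime p) (k : nat) {x : Z2} (px : primitive_mod p x).

Let L := det_lattice (p ^ k) x.

(** Some coordinate of [x] is prime to [p], hence invertible modulo [p ^ k]. The vector [g] will
    generate the quotient by [L]. *)
Lemma det2_unit : exists g c, det2 x g = 1 + (p ^ k)%N%:Z * c.
Proof.
have cop (a : int) : ~~ (p%:Z %| a)%Z -> exists u v, u * a + v * (p ^ k)%N%:Z = 1.
  move=> pa; have [u [v uv]] := Bezoutz a (p ^ k)%N%:Z.
  exists u, v; rewrite uv; apply/eqP; rewrite -/(coprimez _ _) coprimezE /=.
  by rewrite coprime_sym coprimeXl // prime_coprime.
case/nandP: px => /cop[u [v uv]].
  by exists (0, u), (- v); rewrite /det2 /= mulr0 subr0 -uv; ring.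
by exists (- u, 0), (- v); rewrite /det2 /= -uv; ring.
Qed.

Lemma det_lattice_zmod : zmod_closed [in L].
Proof.
split; first by apply/mem_set; rewrite /L /det_lattice /= /det2 !mulr0 subr0 dvdz0.
move=> y z /set_mem Ly /set_mem Lz; apply/mem_set.
by rewrite /L /det_lattice /= det2B rpredB.
Qed.

(** Modulo [p ^ k], the map [det2 x] has kernel [L] and sends [g] to 1, so [y] is congruent to
    [g *~ i] with [i] the residue of [det2 x y]. *)
Lemma det_lattice_cosets {g c} : det2 x g = 1 + (p ^ k)%N%:Z * c ->
  zcosets setT L = [set zcoset L (g *~ i%:Z) | i in `I_(p ^ k)].
Proof.
move=> xg; have q_neq0 : (p ^ k)%N%:Z != 0.
  by rewrite eqz_nat -lt0n expn_gt0 prime_gt0.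
apply/seteqP; split=> [_ [y _ <-]|_ [i _ <-]]; last by eexists.
have := modz_ge0 (det2 x y) q_neq0; have := ltz_mod (det2 x y) q_neq0.
set i := (_ %% _)%Z => ilt ige.
exists `|i|%N; first by rewrite /=; lia.
apply/(zcoset_eqP det_lattice_zmod); rewrite gez0_abs //.
rewrite /L /det_lattice /= det2B det2Mz xg [det2 x y](divz_eq _ (p ^ k)%N%:Z) -/i.
apply/dvdzP; exists (i * c - (det2 x y %/ (p ^ k)%N)%Z); ring.
Qed.

Lemma det_lattice_lattice : lattice L.
Proof.
split; first exact: det_lattice_zmod.
have [g [c /det_lattice_cosets ->]] := det2_unit.
exact/finite_image/finite_II.
Qed.

Lemma det_lattice_index : zindex setT L = (p ^ k)%N.
Proof.
have [g [c xg]] := det2_unit.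
rewrite /zindex (det_lattice_cosets xg) fset_set_image; last exact: finite_II.
rewrite card_in_imfset; first by apply: card_fset_set; exact: card_eqxx.
move=> i j; rewrite !in_fset_set; try exact: finite_II.
rewrite !inE /= => ilt jlt /(zcoset_eqP det_lattice_zmod).
rewrite /L /det_lattice /= det2B !det2Mz -mulrBl xg.
(* The factor [det2 x g] is 1 modulo [p ^ k] and can be cancelled. *)
rewrite Gauss_dvdzl; first by rewrite -eqz_mod_dvd !modz_small ?lez_nat // => /eqP[].
by rewrite coprimez_sym; apply/coprimezP; exists (1, - c) => /=; ring.
Qed.

Lemma det_lattice_cocyclic : cocyclic L.
Proof.
split; first exact: det_lattice_lattice.
have [g [c /det_lattice_cosets E]] := det2_unit; exists g.
apply/seteqP; split=> [y|_ [i _ <-]]; last by eexists.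
by rewrite E => -[i _ <-]; exists i.
Qed.

Lemma det_lattice_self : L x.
Proof. by rewrite /L /det_lattice /= /det2 mulrC subrr dvdz0. Qed.

Lemma lattice_primitiveE (M : set Z2) : lattice M -> zindex setT M = (p ^ k)%N -> M x ->
  M = L.
Proof.
move=> Ml Mk Mx; have [Mz Mfin] := Ml.
apply/esym/eq_lattice_index => //; first exact: det_lattice_lattice.
  have [g [c xg]] := det2_unit => y /dvdzP[d xy].
  (* This is the plane identity det(x, g) y = det(y, g) x + det(x, y) g, with det(x, g) = 1 + p^k c
     and det(x, y) = d p^k. *)
  have -> : y = x *~ det2 y g + (g *~ d - y *~ c) *+ (p ^ k).
    rewrite !pmulrn; apply/eqP/andP; rewrite -!(rwP eqP) /= !(raddfMz fst) !(raddfMz snd) !(raddfB fst) /=.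
    move: xg xy; rewrite /det2 => xg xy; split.
      transitivity (y.1 * (1 + (p ^ k)%N%:Z * c) - y.1 * ((p ^ k)%N%:Z * c)); first by ring.
      transitivity (x.1 * det2 y g + g.1 * (d * (p ^ k)%N%:Z) - y.1 * ((p ^ k)%N%:Z * c)).
        by rewrite -xg -xy /det2; ring.
      by rewrite /det2 !mulrzz; ring.
    transitivity (y.2 * (1 + (p ^ k)%N%:Z * c) - y.2 * ((p ^ k)%N%:Z * c)); first by ring.
    transitivity (x.2 * det2 y g + g.2 * (d * (p ^ k)%N%:Z) - y.2 * ((p ^ k)%N%:Z * c)).
      by rewrite -xg -xy /det2; ring.
    by rewrite /det2 !mulrzz; ring.
  apply: mem_zmodD => //; first exact: mem_zmodMz.
  by rewrite -Mk; exact: mem_zmod_index.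
by rewrite Mk det_lattice_index.
Qed.

End DetLattice.

Lemma det_latticeS (p : nat) {j k : nat} (x : Z2) : (j <= k)%N ->
  det_lattice (p ^ k) x `<=` det_lattice (p ^ j) x.
Proof.
by move=> jk y; apply: dvdz_trans; rewrite dvdzE /= dvdn_exp2l.
Qed.

(** A node of the tree is determined by its level and any one of its primitive vectors, so the
    vector labelling it can be changed at will. *)
Lemma det_latticeE {p : nat} (p_prime : prime p) {k : nat} {x y : Z2} :
  primitive_mod p x -> primitive_mod p y -> det_lattice (p ^ k) x y ->
  det_lattice (p ^ k) x = det_lattice (p ^ k) y.
Proof.
move=> px py xy; apply: lattice_primitiveE => //; first exact: det_lattice_lattice.
exact: det_lattice_index.
Qed.

(** * Primitive vectors, and coverings as cuts of the tree *)

Lemma primitive_mod_e1 {p : nat} : prime p -> primitive_mod p (1, 0).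
Proof. by move=> pp; rewrite /primitive_mod /= dvdz0 andbT dvdzE /= Euclid_dvd1. Qed.

(** Dividing a nonzero vector by [p] decreases the sum of the absolute values of its coordinates, so
    repeated division stops. *)
Lemma primitive_multiple {p : nat} (p_prime : prime p) (y : Z2) :
  exists n x, primitive_mod p x /\ y = x *+ n.
Proof.
have [m] := ubnP (`|y.1| + `|y.2|)%N; elim: m y => // m IHm y ym.
have [-> | y0] := eqVneq y 0.
  by exists 0%N, (1, 0); split; [exact: primitive_mod_e1 | rewrite mulr0n].
have [py | /negPn/andP[/dvdzP[a ya] /dvdzP[b yb]]] := boolP (primitive_mod p y).
  by exists 1%N, y; rewrite mulr1n.
have yE : y = (a, b) *+ p.
  rewrite pmulrn; apply/eqP/andP; rewrite -!(rwP eqP) !(raddfMz fst) !(raddfMz snd) /=.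
  by rewrite !mulrzz -ya -yb.
have p1 := prime_gt1 p_prime.
have [|n [x [px E]]] := IHm (a, b).
  have : (0 < `|a| + `|b|)%N.
    rewrite lt0n; apply: contra y0; rewrite addn_eq0 !absz_eq0 => /andP[/eqP a0 /eqP b0].
    by rewrite yE a0 b0 mul0rn.
  move: ym; rewrite ya yb !abszM /=; nia.
by exists (n * p)%N, x; rewrite yE E mulrnA.
Qed.

(** Otherwise [L] is contained in p Z^2, and the cyclic group Z^2/L would map onto (Z/p)^2. *)
Lemma cocyclic_primitive {p : nat} (p_prime : prime p) {L : set Z2} : cocyclic L ->
  exists2 x, primitive_mod p x & L x.
Proof.
move=> [[Lz _] [g Lg]]; apply: contrapT => noprim.
have Lp y : L y -> (p%:Z %| y.1)%Z /\ (p%:Z %| y.2)%Z.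
  by move=> Ly; apply/andP/negPn/negP => py; apply: noprim; exists y.
have gen y : exists k, (p%:Z %| y.1 - g.1 * k)%Z /\ (p%:Z %| y.2 - g.2 * k)%Z.
  have : zcosets setT L (zcoset L y) by exists y.
  rewrite Lg => -[k _ /esym/(zcoset_eqP Lz)/Lp]; rewrite /= !(raddfMz fst) !(raddfMz snd) /= !mulrzz.
  by exists k.
have [a [/= /dvdzP[c1 a1] /dvdzP[c2 a2]]] := gen (1, 0).
have [b [/= /dvdzP[d1 b1] /dvdzP[d2 b2]]] := gen (0, 1).
have : (p%:Z %| 1)%Z by
  (* In the basis e1, e2 the determinant 1 is congruent to det (a g) (b g) = 0. *)
  apply/dvdzP; exists (c1 + g.1 * a * d2 + d1 * (0 - g.2 * a));
  transitivity ((1 - g.1 * a) + (g.1 * a) * (1 - g.2 * b) + (0 - g.1 * b) * (0 - g.2 * a));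
  [ring | rewrite a1 b2 b1; ring].
by rewrite dvdzE /= Euclid_dvd1.
Qed.

(* The leaves of a finite subtree of the tree of cocyclic lattices of p-power index. *)
Definition tree_covering (p : nat) (C : set (set Z2)) : Prop :=
  [/\ finite_set C, \bigcup_(L in C) L = setT,
      forall L, C L -> exists k x, primitive_mod p x /\ L = det_lattice (p ^ k) x &
      forall L M, C L -> C M -> L `<=` M -> L = M].

Lemma irredundant_tree_covering {p : nat} (p_prime : prime p) {C : set (set Z2)} :
  irredundant_covering C ->
  (forall L, C L -> exists k, zindex setT L = (p ^ k)%N) -> tree_covering p C.
Proof.
move=> [[Cfin Clat Ccov] Cirr] Cpow.
(* Irredundancy in usable form: a subfamily that still covers is all of [C]. *)
have full (D : set (set Z2)) : D `<=` C -> \bigcup_(L in D) L = setT -> C `<=` D.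
  move=> DC Dcov; apply: contrapT => CD; apply: (Cirr D); first by split.
  by split=> //; [exact: sub_finite_set Cfin | exact: subset_trans Clat].
have inC y : exists2 L, C L & L y by have : setT y by []; rewrite -Ccov => -[L]; exists L.
split=> // [L CL | L M CL CM LM].
  have [_ [x px Lx]] : (C `&` [set L | exists2 x, primitive_mod p x & L x]) L.
    apply: full CL => [M [] // | ]; apply/seteqP; split=> // y _.
    have [n [x [px ->]]] := primitive_multiple p_prime y.
    have [M CM Mx] := inC x; exists M; first by split=> //; exists x.
    by have [Mz _] := Clat M CM; exact: mem_zmodMn.
  have [k Lk] := Cpow L CL; exists k, x; split=> //.
  by apply: lattice_primitiveE => //; exact: Clat.
(* If [L] is strictly inside [M], then [C] without [L] still covers. *)
apply: contrapT => neq; have [] : (C `\ L) L; last by move=> _ /(_ erefl).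
apply: full CL => [? [] // | ]; apply/seteqP; split=> // y _.
have [N CN Ny] := inC y; have [EN | NL] := pselect (N = L).
  by exists M; [split=> // ML; exact: neq | apply: LM; rewrite -EN].
by exists N.
Qed.

Lemma tree_covering_covering {p : nat} (p_prime : prime p) {C : set (set Z2)} :
  tree_covering p C -> covering C.
Proof.
move=> [Cfin Ccov Cdet _]; split=> // L /Cdet[k [x [px ->]]].
exact: det_lattice_lattice.
Qed.

(** The children of a node: a descendant has index [p ^ k.+1] by multiplicativity and, being
    cocyclic, contains a primitive [y]. Conversely, such a [y] also labels the parent. *)
Lemma descendants_det_lattice {p : nat} (p_prime : prime p) {k : nat} {x : Z2} {M : set Z2} :
  primitive_mod p x -> descendants p (det_lattice (p ^ k) x) M <->
  exists y, [/\ primitive_mod p y, det_lattice (p ^ k) x y & M = det_lattice (p ^ k.+1) y].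
Proof.
move=> px; have Pl := det_lattice_lattice p_prime k px.
have Pk := det_lattice_index p_prime k px.
split=> [[Mc MP MPp] | [y [py Py ->]]].
  have [y py My] := cocyclic_primitive p_prime Mc; exists y; split=> //; first exact: MP.
  have [Ml _] := Mc; apply: lattice_primitiveE => //.
  by rewrite (zindexM Pl Ml MP) MPp Pk expnSr.
have sub : det_lattice (p ^ k.+1) y `<=` det_lattice (p ^ k) x.
  by rewrite (det_latticeE p_prime px py Py); exact: det_latticeS.
split=> //; first exact: det_lattice_cocyclic.
have /eqP := zindexM Pl (det_lattice_lattice p_prime k.+1 py) sub.
rewrite (det_lattice_index p_prime _ py) Pk expnSr eqn_pmul2l; first by move/eqP/esym.
by rewrite expn_gt0 prime_gt0.
Qed.

Lemma tree_coveringT {p : nat} {C : set (set Z2)} : tree_covering p C -> C setT -> C = [set setT].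
Proof.
move=> [_ _ _ Canti] CT; apply/seteqP; split=> [L CL | _ ->] //.
exact: Canti.
Qed.

(** * Undoing a refinement at a member of maximal index *)

Lemma max_index {C : set (set Z2)} : finite_set C -> C !=set0 ->
  exists2 L, C L & forall M, C M -> (zindex setT M <= zindex setT L)%N.
Proof.
move=> Cfin [L0 CL0]; pose P n := `[< exists2 L, C L & zindex setT L = n >].
have exP : exists n, P n by exists (zindex setT L0); apply/asboolP; exists L0.
have ubP n : P n -> (n <= \max_(L <- fset_set C) zindex setT L)%N.
  move=> /asboolP[L CL <-]; apply: (@leq_bigmax_seq _ _ xpredT) => //.
  by rewrite in_fset_set // in_setE.
case: (ex_maxnP exP ubP) => _ /asboolP[L CL <-] Lmax; exists L => // M CM.
by apply: Lmax; apply/asboolP; exists M.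
Qed.

Definition index_sum (C : set (set Z2)) : nat := (\sum_(L <- fset_set C) zindex setT L)%N.

(** Removing [L] alone already outweighs adding [P]; the other members of [D] can only decrease the
    sum further. *)
Lemma index_sum_coarsen {C D : set (set Z2)} {L P : set Z2} : finite_set C -> C L -> D L ->
  ~ C P -> (zindex setT P < zindex setT L)%N ->
  (index_sum ((C `\` D) `|` [set P]) < index_sum C)%N.
Proof.
move=> Cfin CL DL CP PL; have Efin := @finite_setD _ C D Cfin.
rewrite /index_sum setUC fset_setU1 // big_fsetU1 /=; last first.
  by rewrite in_fset_set //; apply/negP => /set_mem[].
rewrite [X in (_ < X)%N](big_fsetD1 L) /=; last by rewrite in_fset_set // in_setE.
rewrite -addSn leq_add //; set E := fset_set _.
rewrite [X in (_ <= X)%N](bigID (mem E)) /= -[X in (_ <= X + _)%N]big_filter.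
apply: leq_trans (leq_addr _ _); apply: eq_leq; apply: perm_big.
apply: uniq_perm; rewrite ?filter_uniq ?fset_uniq //.
move=> M; rewrite mem_filter !inE; apply/idP/andP => [EM | []//]; split=> //.
move: EM; rewrite !in_fset_set // => /set_mem[CM DM].
by rewrite mem_set // andbT; apply/eqP => ML; apply: DM; rewrite ML.
Qed.

Lemma tree_covering_refinements {p : nat} (p_prime : prime p) {C : set (set Z2)} :
  tree_covering p C -> p_refinements p [set setT] C.
Proof.
have [n] := ubnP (index_sum C); elim: n C => // n IHn C Cn Ct.
have [CT | CT] := pselect (C setT).
  by rewrite (tree_coveringT Ct CT); exact: rt_refl.
have [Cfin Ccov Cdet Canti] := Ct.
have inC y : exists2 L, C L & L y by have : setT y by []; rewrite -Ccov => -[L]; exists L.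
have [|L CL Lmax] := max_index Cfin; first by have [L CL _] := inC 0; exists L.
have [k [x [px LE]]] := Cdet L CL.
(* Level 0 is Z^2 itself, which is excluded here, so [L] has a parent. *)
case: k => [|k] in LE.
  case: CT; suff <- : L = setT by [].
  by apply/seteqP; split=> // y _; rewrite LE /det_lattice /= expn0 dvd1z.
pose P := det_lattice (p ^ k) x.
have level j y : primitive_mod p y -> C (det_lattice (p ^ j) y) -> (j <= k.+1)%N.
  move=> py /Lmax; rewrite LE !det_lattice_index // leq_exp2l //.
  exact: prime_gt1.
have LP : descendants p P L.
  by apply/descendants_det_lattice => //; exists x; split=> //; exact: det_lattice_self.
(* The member [M] covering [y] is the node of [y] at some level [j], at most [k.+1]. If [j <= k],
   then [M] contains [P], hence [L], and the absence of strict inclusions gives [L = M], against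
   their levels. *)
have sub : descendants p P `<=` C.
  move=> _ /(descendants_det_lattice p_prime px)[y [py Py ->]].
  have [M CM My] := inC y; have [j [z [pz ME]]] := Cdet M CM.
  rewrite ME in My; move: ME; rewrite (det_latticeE p_prime pz py My) => ME.
  have := level j y py; rewrite -ME => /(_ CM); rewrite leq_eqVlt => /orP[/eqP jk | jk].
    by rewrite -jk -ME.
  have PM : P `<=` M by rewrite /P (det_latticeE p_prime px py Py) ME; exact: det_latticeS.
  have LM : L = M.
    by apply: Canti => //; case: LP => _ LsubP _; exact: subset_trans PM.
  have : zindex setT L = zindex setT M by rewrite LM.
  rewrite {1}LE ME !det_lattice_index // => /eqP; rewrite eqn_exp2l ?prime_gt1 // => /eqP jE.
  by rewrite -jE ltnn in jk.
have PC : ~ C P.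
  move=> CP; have : zindex setT L = zindex setT P.
    by congr zindex; apply: Canti => //; case: LP.
  rewrite LE !det_lattice_index // => /eqP; rewrite eqn_exp2l ?prime_gt1 //.
  by rewrite (gtn_eqF (ltnSn k)).
pose C' := (C `\` descendants p P) `|` [set P].
have C't : tree_covering p C'.
  split.
  - by rewrite finite_setU; split; [exact: finite_setD | exact: finite_set1].
  - apply/seteqP; split=> // y _; have [M CM My] := inC y.
    have [dM | dM] := pselect (descendants p P M); last by exists M => //; left.
    by exists P; [right | case: dM => _ + _; apply].
  - by move=> M [[/Cdet] // | ->]; exists k, x.
  (* A surviving [M] above [P] would contain [L], hence equal it. One below [P] is either a child of
     [P], at level [k.+1], or [P] itself. *)
  have anti M : C M -> ~ descendants p P M -> ~ (M `<=` P) /\ ~ (P `<=` M).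
    move=> CM dM; split=> [MP | PM]; last first.
      apply: dM; suff <- : L = M by [].
      by apply: Canti => //; case: LP => _ LsubP _; exact: subset_trans PM.
    have [j [y [py ME]]] := Cdet M CM.
    have Py : P y by apply: MP; rewrite ME; exact: det_lattice_self.
    have := level j y py; rewrite -ME => /(_ CM); rewrite leq_eqVlt => /orP[/eqP jk | jk].
      by apply: dM; apply/descendants_det_lattice => //; exists y; rewrite -jk.
    apply: PC; suff -> : P = M by [].
    apply/seteqP; split=> //; rewrite /P (det_latticeE p_prime px py Py) ME.
    exact: det_latticeS.
  move=> M N [[CM dM] | ->] [[CN dN] | ->] //; first exact: Canti.
    by move/(proj1 (anti M CM dM)).
  by move/(proj2 (anti N CN dN)).
(* The induction hypothesis reaches [C'], and one last refinement at [P] gives back [C]. *)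
apply: (rt_trans _ _ _ C').
  apply: IHn => //; apply: leq_trans (index_sum_coarsen Cfin CL LP PC _) _ => //.
  by rewrite LE !det_lattice_index // ltn_exp2l // prime_gt1.
apply: rt_step; split; first exact: tree_covering_covering C't.
  move=> M; have [_ _ C'det _] := C't.
  by move=> /C'det[j [y [py ->]]]; exact: det_lattice_cocyclic.
exists P; first by right.
apply/seteqP; split=> [M CM | M [[[[CM _] | MP] nMP] | dM]] //; last exact: sub.
have [dM | dM] := pselect (descendants p P M); [by right | left].
by split; [left | move=> MP; apply: PC; rewrite -MP].
Qed.

Theorem theoremA (p : nat) (hp : prime p) (C : set (set Z2))
    (hC : irredundant_covering C)
    (hpow : forall L : set Z2, C L -> exists k : nat, zindex setT L = (p ^ k)%N) :
  p_refinements p [set setT] C.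
Proof.
exact/(tree_covering_refinements hp)/irredundant_tree_covering.
Qed.
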